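(* Let $n\in\mathbb{N}$, $n\ge 2$, and let $DC_{4n}=\langle a,x\mid a^{2n}=e,\ x^{2}=a^{n},\ x^{-1}ax=a^{-1}\rangle$ (the classical presentation of this group). (1) If $2\mid n$, then there are two equivalence classes of minimal presentations with two generators of $DC_{4n}$: that of the classical presentation and that of $\Pi_{4n,1}=\langle u,v\mid u^2=v^2,\ u^4=u^2(u^3v)^{n}=e\rangle$. (2) If $2\nmid n$, then there are four equivalence classes of minimal presentations with two generators of $DC_{4n}$: those of the classical presentation, of $\Pi_{4n,1}=\langle u,v\mid u^2=v^2,\ u^4=u^2(u^3v)^{n}=e\rangle$, of $\Pi_{4n,0}=\langle u,v\mid u^2=v^2,\ u^4=u^2(uv)^{n}=e\rangle$, and of $\Pi_{4n,n}=\langle b,y\mid b^n=e,\ y^4=e,\ y^{-1}by=b^{-1}\rangle$.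
   Context: For a finite group $G$ and a finite sequence $\mathcal{S}$ of elements of $G$ with underlying set $S$, the Cayley graph $\Gamma(G,\mathcal{S})$ is the edge-labeled directed graph with vertex set $G$, edge-label set $S$, and, for each $g\in G$ and $s\in S$, a directed edge $g\to sg$ labeled $s$. Two edge-labeled directed graphs with vertex sets $V_1,V_2$ and label sets $k_1,k_2$ are isomorphic (written $\simeq$) if there are bijections $f:V_1\to V_2$ and $\sigma:k_1\to k_2$ such that for all vertices $p,q$ and labels $w$ there is an edge $p\to q$ labeled $w$ in the first graph if and only if there is an edge $f(p)\to f(q)$ labeled $\sigma(w)$ in the second. A presentation $\langle\mathcal{S}\mid R\rangle$ of $G$ consists of a generating sequence $\mathcal{S}$ of $G$ and a set $R$ of relations between the elements of $\mathcal{S}$. Two presentations $\langle\mathcal{S}_1\mid R_1\rangle$, $\langle\mathcal{S}_2\mid R_2\rangle$ of $G$ (and the corresponding generating sequences) are called equivalent if $\Gamma(G,\mathcal{S}_1)\simeq\Gamma(G,\mathcal{S}_2)$. So the equivalence class of a presentation depends only on its generating sequence. A presentation is minimal if no proper subsequence of its generating sequence generates $G$. An abstract presentation such as $\Pi_{4n,1}$ is regarded as a presentation of $DC_{4n}$ via an isomorphism of the group it defines with $DC_{4n}$; a different choice of isomorphism gives an equivalent presentation.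
   Formalization: In (1), the two classes are claimed to be distinct only for n ≠ 2: for n = 2 the group is the quaternion group, the classical generators also satisfy the relations of Π_{8,1}, and the two classes coincide. *)

(* Defs.v *)
From mathcomp Require Import all_boot all_fingroup.
Set Implicit Arguments.
Unset Strict Implicit.
Unset Printing Implicit Defensive.

Local Open Scope group_scope.

Record ldigraph := LDigraph {
  vertex : Type;
  label : Type;
  edge : vertex -> label -> vertex -> Prop
}.

Definition ldigraph_iso (X Y : ldigraph) : Prop :=
  exists (f : vertex X -> vertex Y) (sigma : label X -> label Y),
    [/\ bijective f, bijective sigma
      & forall p w q, edge p w q <-> edge (f p) (sigma w) (f q)].

(* Labels are the elements of the underlying set of S, so repetitions in S do
   not count; edges multiply on the left. *)
Definition cayley (gT : finGroupType) (S : seq gT) : ldigraph :=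
  {| vertex := gT;
     label := seq_sub S;
     edge := fun g s h => h = ssval s * g |}.

Definition equivalent (gT : finGroupType) (S T : seq gT) : Prop :=
  ldigraph_iso (cayley S) (cayley T).

(* Words in k symbols and their formal inverses; (i, true) is the inverse of
   the i-th symbol. *)
Definition word (k : nat) := seq ('I_k * bool).
Definition relation (k : nat) := (word k * word k)%type.

Definition wgen k (i : 'I_k) : word k := [:: (i, false)].
Definition wexp k (w : word k) (m : nat) : word k := flatten (nseq m w).
Definition winv k (w : word k) : word k := rev [seq (l.1, ~~ l.2) | l <- w].

(* Equality in the group < symbols | R >: the quotient of the set of words by
   this congruence is the free group modulo the normal closure of the
   r1 r2^-1, for (r1, r2) in R. *)
Inductive eq_mod k (R : relation k -> Prop) : word k -> word k -> Prop :=
| eq_mod_refl w : eq_mod R w w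
| eq_mod_sym w1 w2 : eq_mod R w1 w2 -> eq_mod R w2 w1
| eq_mod_trans w1 w2 w3 : eq_mod R w1 w2 -> eq_mod R w2 w3 -> eq_mod R w1 w3
| eq_mod_cancel w1 i b w2 :
    eq_mod R (w1 ++ [:: (i, b); (i, ~~ b)] ++ w2) (w1 ++ w2)
| eq_mod_rel w1 r1 r2 w2 :
    R (r1, r2) -> eq_mod R (w1 ++ r1 ++ w2) (w1 ++ r2 ++ w2).

Definition weval (gT : finGroupType) k (S : k.-tuple gT) (w : word k) : gT :=
  \prod_(l <- w) (if l.2 then (tnth S l.1)^-1 else tnth S l.1).

(* < S | R > is a presentation of the whole group gT: sending the i-th symbol
   to the i-th term of S induces an isomorphism from < symbols | R > to gT. *)
Definition is_presentation (gT : finGroupType) k (S : k.-tuple gT)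
    (R : relation k -> Prop) : Prop :=
  <<[set:: S]>> = [set: gT]
  /\ forall w1 w2, weval S w1 = weval S w2 <-> eq_mod R w1 w2.

Definition minimal (gT : finGroupType) (S : seq gT) : Prop :=
  forall T : seq gT, subseq T S -> T <> S -> <<[set:: T]>> <> [set: gT].

Definition symb0 : word 2 := wgen ord0.
Definition symb1 : word 2 := wgen ord_max.

Definition classical_rels (n : nat) : relation 2 -> Prop :=
  let a := symb0 in let x := symb1 in
  fun r => r \in [:: (wexp a (2 * n), [::]);
                     (wexp x 2, wexp a n);
                     (winv x ++ a ++ x, winv a)].

Definition Pi1_rels (n : nat) : relation 2 -> Prop :=
  let u := symb0 in let v := symb1 in
  fun r => r \in [:: (wexp u 2, wexp v 2);
                     (wexp u 4, [::]);
                     (wexp u 2 ++ wexp (wexp u 3 ++ v) n, [::])].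

Definition Pi0_rels (n : nat) : relation 2 -> Prop :=
  let u := symb0 in let v := symb1 in
  fun r => r \in [:: (wexp u 2, wexp v 2);
                     (wexp u 4, [::]);
                     (wexp u 2 ++ wexp (u ++ v) n, [::])].

Definition Pin_rels (n : nat) : relation 2 -> Prop :=
  let b := symb0 in let y := symb1 in
  fun r => r \in [:: (wexp b n, [::]);
                     (wexp y 4, [::]);
                     (winv y ++ b ++ y, winv b)].

(* The classes of the listed generating pairs are all the classes of minimal
   presentations with two generators; listed classes may still coincide. *)
Definition cover_classes (gT : finGroupType) (reps : seq (2.-tuple gT)) : Prop :=
  (forall T, T \in reps -> minimal T)
  /\ forall (S : 2.-tuple gT) (R : relation 2 -> Prop),
       is_presentation S R -> minimal S ->
       exists2 T, T \in reps & equivalent S T.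

Definition pairwise_inequivalent (gT : finGroupType)
    (reps : seq (2.-tuple gT)) : Prop :=
  forall i j : 'I_(size reps), i != j ->
    ~ equivalent (tnth (in_tuple reps) i) (tnth (in_tuple reps) j).

(* Main.v *)
Require Import Defs.
From HB Require Import structures.
From mathcomp Require Import all_boot all_fingroup.
From mathcomp Require Import generic_quotient ssralg zmodp cyclic.
From mathcomp Require boolp.

Set Implicit Arguments.
Unset Strict Implicit.
Unset Printing Implicit Defensive.

Local Open Scope quotient_scope.
Local Open Scope group_scope.

(** The group is G = A u Ax with A = <a> of order 2n, where every element
    outside A squares to a^n and inverts A by conjugation.  This makes the
    generating pairs easy to list.  If s is in A and t is not, then s^n is 1 or
    a^n; in the second case (s, t) satisfies the defining relations of (a, x),
    in the first one it satisfies those of Pi_{4n,n}.  If neither s nor t is in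
    A, then c = s^-1 t is in A, and c^n = a^n gives the relations of Pi_{4n,1},
    whereas c^n = 1 gives those of Pi_{4n,0} when n is odd.  When n is even, an
    element c of A with c^n = 1 never generates G together with an element
    outside A, so that only two cases survive (generating_pair_cases).

    It remains to compare generating pairs.  A presentation has the universal
    property of von Dyck's theorem (presentation_hom, universal_presentation),
    so that two pairs that generate the finite group G and satisfy the relations
    of one presentation are exchanged by an automorphism.  On the other hand,
    two generating sequences have isomorphic Cayley graphs exactly when an
    automorphism carries one label set onto the other (equivalent_hom,
    hom_equivalent): normalising the bijection of vertices so that it fixes 1
    makes it multiplicative.  The first fact shows that the pairs listed above
    fall into at most two, respectively four, classes.  The second one
    separates these classes by invariants of automorphisms: the orders of the
    generators, which are {2n, 4}, {4, 4}, {4, 4} and {n, 4}, and the n-th power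
    of u^-1 v, which tells Pi_{4n,1} from Pi_{4n,0}.  The orders fail to
    separate the first two classes for n = 2 only, when 2n = 4.

    That the three other sets of relations do present G follows from Tietze
    substitutions: (u^3 v, u), (u v, u) and (b y^2, y) satisfy the relations of
    (a, x) in every group, the last one for odd n, and these substitutions are
    inverse to (x, x a), (x, x^-1 a) and (a x^2, x).  Finally, a has order exactly 2n
    because G maps to a concrete group of permutations where this is visible
    (model_a_order). *)

(** * Evaluation of words in an arbitrary group *)

Lemma winv_cat k (w1 w2 : word k) : winv (w1 ++ w2) = winv w2 ++ winv w1.
Proof. by rewrite /winv map_cat rev_cat. Qed.

Lemma winvK k : involutive (@winv k).
Proof.
move=> w; rewrite /winv map_rev revK -map_comp map_id_in // => -[i b] _ /=.
by rewrite negbK.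
Qed.

Section Evaluation.

Variables (G : groupType) (k : nat) (U : k.-tuple G).

(** The evaluation weval, for groups that may be infinite: nothing bounds the
    group defined by a set of relations beforehand. *)
Definition geval (w : word k) : G :=
  \prod_(l <- w) (if l.2 then (tnth U l.1)^-1 else tnth U l.1).

Lemma geval_nil : geval [::] = 1.
Proof. exact: big_nil. Qed.

Lemma geval_gen i : geval (wgen i) = tnth U i.
Proof. by rewrite /geval big_seq1. Qed.

Lemma geval_cat w1 w2 : geval (w1 ++ w2) = geval w1 * geval w2.
Proof. exact: big_cat. Qed.

Lemma geval_exp w m : geval (wexp w m) = geval w ^+ m.
Proof.
by elim: m => [|m IHm]; rewrite ?geval_nil // expgS -IHm -geval_cat.
Qed.

Lemma geval_inv w : geval (winv w) = (geval w)^-1.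
Proof.
elim: w => [|[i b] w IHw]; first by rewrite geval_nil invg1.
rewrite -cat1s winv_cat !geval_cat IHw invgM; congr (_ * _).
by case: b; rewrite /geval !big_seq1 //= invgK.
Qed.

Definition satisfies (R : relation k -> Prop) : Prop :=
  forall w1 w2, R (w1, w2) -> geval w1 = geval w2.

Lemma geval_eq_mod R w1 w2 :
  satisfies R -> eq_mod R w1 w2 -> geval w1 = geval w2.
Proof.
move=> RU.
elim=> {w1 w2} // [w1 w2 w3 _ -> _ -> //|w1 i b w2|w1 r1 r2 w2 /RU r12].
  rewrite !geval_cat; congr (_ * _).
  rewrite /geval !big_cons big_nil /= mulg1.
  by case: b => /=; rewrite ?mulVg ?mulgV mul1g.
by rewrite !geval_cat r12.
Qed.

End Evaluation.

(** * The group defined by a set of relations *)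

Section PresentedGroup.

Variables (k : nat) (R : relation k -> Prop).

(** The quotient type needs a boolean relation; the congruence is undecidable in
    general, so excluded middle decides it. *)
Definition eq_modb (w1 w2 : word k) : bool := boolp.asbool (eq_mod R w1 w2).

Lemma eq_modbP w1 w2 : reflect (eq_mod R w1 w2) (eq_modb w1 w2).
Proof. exact: boolp.asboolP. Qed.

Lemma eq_modb_refl : reflexive eq_modb.
Proof. by move=> w; apply/eq_modbP/eq_mod_refl. Qed.

Lemma eq_modb_sym : symmetric eq_modb.
Proof. by move=> w1 w2; apply/eq_modbP/eq_modbP; apply: eq_mod_sym. Qed.

Lemma eq_modb_trans : transitive eq_modb.
Proof.
move=> w2 w1 w3 /eq_modbP w12 /eq_modbP w23.
exact/eq_modbP/(eq_mod_trans w12).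
Qed.

Canonical eq_modb_equiv :=
  EquivRel eq_modb eq_modb_refl eq_modb_sym eq_modb_trans.

Definition presented_group : Type := {eq_quot eq_modb}.

HB.instance Definition _ := Choice.on presented_group.
HB.instance Definition _ := EqQuotient.on presented_group.

Definition cls (w : word k) : presented_group := \pi_presented_group w.

Lemma cls_repr (x : presented_group) : cls (repr x) = x.
Proof. exact: reprK. Qed.

Lemma clsP w1 w2 : cls w1 = cls w2 <-> eq_mod R w1 w2.
Proof. by split=> [/eqmodP/eq_modbP | w12]; last apply/eqmodP/eq_modbP. Qed.

Lemma eq_mod_cat2 w v1 v2 w' :
  eq_mod R v1 v2 -> eq_mod R (w ++ v1 ++ w') (w ++ v2 ++ w').
Proof.
elim=> {v1 v2} [v|v1 v2 _|v1 v2 v3 _ IH12 _|v1 i b v2|v1 r1 r2 v2 Rr].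
- exact: eq_mod_refl.
- exact: eq_mod_sym.
- exact: eq_mod_trans.
- by rewrite -!catA (catA w) (catA w v1); apply: eq_mod_cancel.
- by rewrite -!catA (catA w) (catA w v1); apply: eq_mod_rel.
Qed.

Lemma eq_mod_cat v1 v2 w1 w2 :
  eq_mod R v1 v2 -> eq_mod R w1 w2 -> eq_mod R (v1 ++ w1) (v2 ++ w2).
Proof.
move=> v12 w12; apply: (@eq_mod_trans _ _ _ (v2 ++ w1)).
  exact: (eq_mod_cat2 [::] w1 v12).
by have := eq_mod_cat2 v2 [::] w12; rewrite !cats0.
Qed.

Lemma eq_mod_mulVw w : eq_mod R (winv w ++ w) [::].
Proof.
elim: w => [|[i b] w IHw]; first exact: eq_mod_refl.
rewrite -cat1s winv_cat -catA; apply: eq_mod_trans IHw.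
by have := eq_mod_cancel R (winv w) i (~~ b) w; rewrite negbK.
Qed.

Lemma eq_mod_mulwV w : eq_mod R (w ++ winv w) [::].
Proof. by rewrite -{1}[w]winvK; apply: eq_mod_mulVw. Qed.

Lemma eq_mod_inv w1 w2 : eq_mod R w1 w2 -> eq_mod R (winv w1) (winv w2).
Proof.
move=> w12; apply: (@eq_mod_trans _ _ _ (winv w1 ++ w2 ++ winv w2)).
  apply: eq_mod_sym; rewrite -{2}[winv w1]cats0.
  exact: eq_mod_cat (eq_mod_refl _ _) (eq_mod_mulwV _).
rewrite catA -[X in eq_mod R _ X]cat0s.
apply: eq_mod_cat (eq_mod_refl _ _); apply: eq_mod_trans (eq_mod_mulVw w1).
exact: eq_mod_cat (eq_mod_refl _ _) (eq_mod_sym w12).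
Qed.

Definition presented_one : presented_group := cls [::].
Definition presented_mul (x y : presented_group) : presented_group :=
  cls (repr x ++ repr y).
Definition presented_inv (x : presented_group) : presented_group :=
  cls (winv (repr x)).

Lemma repr_cls w : eq_mod R (repr (cls w)) w.
Proof. by apply/clsP; rewrite cls_repr. Qed.

Lemma presented_mulE w1 w2 :
  presented_mul (cls w1) (cls w2) = cls (w1 ++ w2).
Proof. by apply/clsP/eq_mod_cat; apply: repr_cls. Qed.

Lemma presented_invE w : presented_inv (cls w) = cls (winv w).
Proof. by apply/clsP/eq_mod_inv/repr_cls. Qed.

Lemma presented_mulA : associative presented_mul.
Proof.
move=> x y z; rewrite -[x]cls_repr -[y]cls_repr -[z]cls_repr.
by rewrite !presented_mulE catA.
Qed.

Lemma presented_mul1 : left_id presented_one presented_mul.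
Proof. by move=> x; rewrite -[x]cls_repr presented_mulE. Qed.

Lemma presented_mul1r : right_id presented_one presented_mul.
Proof. by move=> x; rewrite -[x]cls_repr presented_mulE cats0. Qed.

Lemma presented_mulV : left_inverse presented_one presented_inv presented_mul.
Proof.
move=> x; rewrite -[x]cls_repr presented_invE presented_mulE.
exact/clsP/eq_mod_mulVw.
Qed.

Lemma presented_mulVr : right_inverse presented_one presented_inv presented_mul.
Proof.
move=> x; rewrite -[x]cls_repr presented_invE presented_mulE.
exact/clsP/eq_mod_mulwV.
Qed.

HB.instance Definition _ := isGroup.Build presented_group
  presented_mulA presented_mul1 presented_mul1r presented_mulV presented_mulVr.

Definition presented_gens : k.-tuple presented_group :=
  [tuple cls (wgen i) | i < k].

Lemma geval_presented w : geval presented_gens w = cls w.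
Proof.
elim: w => [|[i b] w IHw]; first by rewrite geval_nil.
rewrite -cat1s geval_cat IHw -presented_mulE; congr (_ * _).
rewrite /geval big_seq1 /= tnth_mktuple.
by case: b => //=; apply: presented_invE.
Qed.

Lemma presented_satisfies : satisfies presented_gens R.
Proof.
move=> w1 w2 Rw; rewrite !geval_presented; apply/clsP.
by have := eq_mod_rel [::] [::] Rw; rewrite !cats0.
Qed.

End PresentedGroup.

(** * The universal property of a presentation *)

Section UniversalProperty.

Variables (gT : finGroupType) (k : nat).
Implicit Types (S T : k.-tuple gT) (R : relation k -> Prop).

Definition generates (S : seq gT) : Prop := <<[set:: S]>> = [set: gT].

Lemma gmulf_geval (G H : groupType) (phi : UMagmaMorphism.type G H)
    (U : k.-tuple G) w :
  phi (geval U w) = geval (map_tuple phi U) w.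
Proof.
rewrite /geval gmulf_prod; apply: eq_bigr => -[i []] _ /=.
  by rewrite gmulfV tnth_map.
by rewrite tnth_map.
Qed.

Lemma generates_word S g : generates S -> exists w, weval S w = g.
Proof.
move=> genS; have /gen_prodgP[m [c cS ->]] : g \in <<[set:: S]>>.
  by rewrite genS inE.
elim: m c cS => [|m IHm] c cS;
  first by exists [::]; rewrite big_ord0 /weval big_nil.
rewrite big_ord_recl.
have [w <-] := IHm _ (fun i => cS (lift ord0 i)).
have := cS ord0; rewrite inE => /tnthP[i ->].
by exists (wgen i ++ w); rewrite -[LHS]/(geval S _) geval_cat geval_gen.
Qed.

Lemma generates_ind (S : seq gT) (P : gT -> Prop) :
    generates S -> P 1 -> {in S, forall s g, P g -> P (s * g)} -> forall g, P g.
Proof.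
move=> genS P1 PS g; have /gen_prodgP[m [c cS ->]] : g \in <<[set:: S]>>.
  by rewrite genS inE.
elim: m c cS => [|m IHm] c cS; first by rewrite big_ord0.
rewrite big_ord_recl; apply: PS; last by apply: IHm => i; apply: cS.
by have := cS ord0; rewrite inE.
Qed.

(** Von Dyck's theorem: the image of g is the value of any word representing g,
    and the choice of the word does not matter because words with the same value
    are congruent modulo the relations, which hold among the entries of U. *)
Lemma presentation_hom S R (Q : groupType) (U : k.-tuple Q) :
    is_presentation S R -> satisfies U R ->
  exists phi : UMagmaMorphism.type gT Q, map_tuple phi S = U.
Proof.
case=> genS presS RU.
have ex_word g : exists w, weval S w == g.
  by have [w <-] := generates_word g genS; exists w.
pose phi g := geval U (xchoose (ex_word g)).
have phiE w : phi (weval S w) = geval U w.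
  by apply: (geval_eq_mod RU); apply/presS/eqP/(xchooseP (ex_word _)).
have phi_mor : {morph phi : x y / x * y^-1}.
  move=> x y; have [v <-] := generates_word x genS.
  have [w <-] := generates_word y genS.
  rewrite !phiE -geval_inv -geval_cat -phiE; congr phi.
  by rewrite -[RHS]/(geval S _) geval_cat geval_inv.
pose phiM := HB.pack_for (UMagmaMorphism.type gT Q) phi
  (isGroupMorphism.Build _ _ phi phi_mor).
exists phiM; apply: eq_from_tnth => i; rewrite tnth_map.
by rewrite -[LHS]/(phi _) -(geval_gen S) phiE geval_gen.
Qed.

Lemma satisfies_presentation S R : is_presentation S R -> satisfies S R.
Proof.
case=> _ presS w1 w2 Rw; apply/presS.
by have := eq_mod_rel [::] [::] Rw; rewrite !cats0.
Qed.

(** The converse of von Dyck's theorem: applied to the group defined by R, the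
    universal property separates all words that are not congruent modulo R. *)
Lemma universal_presentation T R :
    generates T -> satisfies T R ->
    (forall (Q : groupType) (U : k.-tuple Q), satisfies U R ->
       exists phi : UMagmaMorphism.type gT Q, map_tuple phi T = U) ->
  is_presentation T R.
Proof.
move=> genT RT univT; split=> // w1 w2; split; last exact: geval_eq_mod.
have [phi phiT] := univT _ _ (@presented_satisfies _ R).
move=> w12; apply/clsP; rewrite -!geval_presented -phiT -!gmulf_geval.
by congr (phi _).
Qed.

End UniversalProperty.

(** * Equivalent generating sequences and automorphisms *)

Section Equivalence.

Variable gT : finGroupType.

Lemma hom_onto (phi : UMagmaMorphism.type gT gT) (S T : seq gT) :
  generates T -> {subset T <= map phi S} -> bijective phi.
Proof.
move=> genT subT; suff surj (g : gT) : exists h, phi h == g.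
  have psiK : cancel (fun g => xchoose (surj g)) phi.
    by move=> g; apply/eqP/(xchooseP (surj g)).
  exact: (bij_can_bij (injF_bij (can_inj psiK)) psiK).
move: g; apply: (generates_ind genT) => [|t /subT/mapP[s _ ->] g [h /eqP <-]].
  by exists 1; rewrite gmulf1.
by exists (s * h); rewrite gmulfM.
Qed.

Lemma satisfies_hom k (S T : k.-tuple gT) (R : relation k -> Prop) :
    is_presentation S R -> generates T -> satisfies T R ->
  exists2 phi : UMagmaMorphism.type gT gT, bijective phi & map_tuple phi S = T.
Proof.
move=> presS genT RT; have [phi phiS] := presentation_hom presS RT.
by exists phi => //; apply: (@hom_onto _ S T) => // t; rewrite -phiS.
Qed.

(** In a finite group the homomorphism of von Dyck's theorem between two
    generating sequences is an automorphism, so that the relations of one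
    presentation define the group on every generating sequence where they
    hold. *)
Lemma satisfies_is_presentation k (S T : k.-tuple gT) (R : relation k -> Prop) :
    is_presentation S R -> generates T -> satisfies T R ->
  is_presentation T R.
Proof.
move=> presS genT RT; have [phi phi_bij phiS] := satisfies_hom presS genT RT.
have [_ presSR] := presS; split=> // w1 w2; rewrite -presSR.
have phi_weval w : weval T w = phi (weval S w).
  by rewrite -phiS (gmulf_geval phi S).
by rewrite !phi_weval; split=> [/(bij_inj phi_bij) | ->].
Qed.

(** An isomorphism of Cayley graphs satisfies f (s g) = sigma s * f g; dividing
    by f 1 on the right turns it into a map phi that sends s to sigma s.  Then
    phi (s g) = phi s * phi g, and multiplicativity follows by induction on
    products of generators. *)
Lemma equivalent_hom (S T : seq gT) :
    generates S -> equivalent S T ->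
  exists2 phi : UMagmaMorphism.type gT gT, bijective phi & map phi S =i T.
Proof.
move=> genS [f [sigma [f_bij sigma_bij fE]]].
pose phi g : gT := f g * (f 1)^-1.
have phi1 : phi 1 = 1 by rewrite /phi mulgV.
have f_step s g : f (ssval s * g) = ssval (sigma s) * f g.
  exact/(fE g s (ssval s * g)).
have phi_step s g : phi (ssval s * g) = ssval (sigma s) * phi g.
  by rewrite /phi f_step mulgA.
have phi_gen s : phi (ssval s) = ssval (sigma s).
  by rewrite -[ssval s]mulg1 phi_step phi1 mulg1.
have phi_mor : {morph phi : x y / x * y}.
  move=> g h; move: g; apply: (generates_ind genS) => [|s sS g IHg].
    by rewrite phi1 !mul1g.
  have := phi_step (SeqSub sS); rewrite /= => phis.
  by rewrite -mulgA !phis IHg mulgA.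
pose phiM := HB.pack_for (UMagmaMorphism.type gT gT) phi
  (isUMagmaMorphism.Build _ _ phi (phi1, phi_mor)).
exists phiM.
  have [g gK Kg] := f_bij.
  exists (fun h => g (h * f 1)) => h /=; first by rewrite /phi mulgKV gK.
  by rewrite /phi Kg mulgK.
have [tau _ tauK] := sigma_bij.
move=> t; apply/mapP/idP => [[s sS ->] | tT].
  by rewrite /= (phi_gen (SeqSub sS)); apply: valP.
exists (ssval (tau (SeqSub tT))); first exact: valP.
by rewrite /= phi_gen tauK.
Qed.

Lemma hom_equivalent (phi : UMagmaMorphism.type gT gT) (S T : seq gT) :
  bijective phi -> map phi S =i T -> equivalent S T.
Proof.
move=> phi_bij phiS; have [psi phiK psiK] := phi_bij.
have phi_lab (w : seq_sub S) : phi (ssval w) \in T.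
  by rewrite -phiS map_f //; apply: valP.
have psi_lab (w : seq_sub T) : psi (ssval w) \in S.
  by have := valP w; rewrite -phiS => /mapP[s sS /= ->]; rewrite phiK.
exists phi, (fun w => SeqSub (phi_lab w)); split=> //.
  by exists (fun w => SeqSub (psi_lab w)) => w; apply: val_inj;
    [exact: phiK | exact: psiK].
move=> p w q /=; rewrite -gmulfM; split=> [-> // | ].
exact: (can_inj phiK).
Qed.

Lemma equivalent_sym (S T : seq gT) : equivalent S T -> equivalent T S.
Proof.
case=> f [sigma [[g fK gK] [tau sK tK] fE]]; exists g, tau; split.
- by exists f.
- by exists sigma.
move=> p w q; have := fE (g p) (tau w) (g q); rewrite !gK tK.
exact: iff_sym.
Qed.

(** Only the set of generators matters for equivalence, so the relations may
    hold for S' after a reordering. *)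
Lemma satisfies_equivalent k (S T : k.-tuple gT) (S' : seq gT)
    (R : relation k -> Prop) :
    is_presentation T R -> generates S -> satisfies S R -> S' =i S ->
  equivalent S' T.
Proof.
move=> presT genS RS eqS; apply: equivalent_sym.
have [phi phi_bij phiT] := satisfies_hom presT genS RS.
by apply: hom_equivalent phi_bij _ => s; rewrite eqS -phiT.
Qed.

End Equivalence.

(** * The four sets of relations and the substitutions between them *)

Lemma expg_odd_involution (G : groupType) (z : G) n :
  odd n -> z ^+ 2 = 1 -> z ^+ n = z.
Proof.
move=> n_odd z2; rewrite -[n]odd_double_half n_odd expgS -mul2n expgnA z2.
by rewrite expg1n mulg1.
Qed.

Section Relations.

Variables (G : groupType) (n : nat).
Implicit Types a x u v b y : G.

Definition dicyclic_pair a x : Prop :=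
  [/\ a ^+ (2 * n) = 1, x ^+ 2 = a ^+ n & a ^ x = a^-1].

Definition Pi1_pair u v : Prop :=
  [/\ u ^+ 2 = v ^+ 2, u ^+ 4 = 1 & u ^+ 2 * (u ^+ 3 * v) ^+ n = 1].

Definition Pi0_pair u v : Prop :=
  [/\ u ^+ 2 = v ^+ 2, u ^+ 4 = 1 & u ^+ 2 * (u * v) ^+ n = 1].

Definition Pin_pair b y : Prop := [/\ b ^+ n = 1, y ^+ 4 = 1 & b ^ y = b^-1].

Lemma satisfies3 (U : 2.-tuple G) (l1 r1 l2 r2 l3 r3 : word 2) :
  satisfies U (fun r => r \in [:: (l1, r1); (l2, r2); (l3, r3)]) <->
  [/\ geval U l1 = geval U r1, geval U l2 = geval U r2
    & geval U l3 = geval U r3].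
Proof.
split=> [RU | [E1 E2 E3] w1 w2].
  by split; apply: RU; rewrite !inE eqxx ?orbT.
by rewrite !inE => /or3P[] /eqP[-> ->].
Qed.

Definition gevalE :=
  (geval_cat, geval_exp, geval_inv, geval_gen, geval_nil).

Lemma satisfies_classical a x :
  satisfies [tuple a; x] (classical_rels n) <-> dicyclic_pair a x.
Proof. by apply: iff_trans (satisfies3 _ _ _ _ _ _ _) _; rewrite !gevalE. Qed.

Lemma satisfies_Pi1 u v : satisfies [tuple u; v] (Pi1_rels n) <-> Pi1_pair u v.
Proof. by apply: iff_trans (satisfies3 _ _ _ _ _ _ _) _; rewrite !gevalE. Qed.

Lemma satisfies_Pi0 u v : satisfies [tuple u; v] (Pi0_rels n) <-> Pi0_pair u v.
Proof. by apply: iff_trans (satisfies3 _ _ _ _ _ _ _) _; rewrite !gevalE. Qed.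

Lemma satisfies_Pin b y : satisfies [tuple b; y] (Pin_rels n) <-> Pin_pair b y.
Proof. by apply: iff_trans (satisfies3 _ _ _ _ _ _ _) _; rewrite !gevalE. Qed.

Lemma dicyclic_expg4 a x : dicyclic_pair a x -> x ^+ 4 = 1.
Proof. by case=> an x2 _; rewrite (expgnA x 2 2) x2 -expgnA mulnC. Qed.

Lemma dicyclic_Pi1 a x : dicyclic_pair a x -> Pi1_pair x (x * a).
Proof.
move=> dic; have x4 := dicyclic_expg4 dic; have [an x2 ax] := dic; split=> //.
  by rewrite !expg2 -mulgA (mulgA a) (conjgC a) ax mulgVK.
by rewrite mulgA -expgSr x4 mul1g x2 -expgnDr addnn -mul2n.
Qed.

(** The last relation says that a = u^3 v = u^-1 v has a^n = u^2, whose
    square is 1; as v^4 = u^4 = 1, the product a * a^u = u^3 v^4 u is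
    trivial. *)
Lemma Pi1_dicyclic u v : Pi1_pair u v -> dicyclic_pair (u ^+ 3 * v) u.
Proof.
case=> uv u4 an; have {}an : u ^+ 2 = (u ^+ 3 * v) ^+ n.
  by apply: (mulgI (u ^+ 2)); rewrite an -expgnDr.
split=> //; first by rewrite mulnC expgnA -an -expgnA.
have v4 : v ^+ 4 = 1 by rewrite (expgnA v 2 2) -uv -expgnA.
have -> : (u ^+ 3 * v) ^ u = v ^+ 2 * (v * u).
  by rewrite conjgE (expgS u 2) -(mulgA u) -mulgA mulKg uv -mulgA.
apply/esym/mulg1_eq; rewrite -mulgA (mulgA v) -expgS (mulgA (v ^+ 3)) -expgSr.
by rewrite v4 mul1g -expgSr.
Qed.

Lemma dicyclic_Pi0 a x : dicyclic_pair a x -> Pi0_pair x (x^-1 * a).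
Proof.
move=> dic; have x4 := dicyclic_expg4 dic; have [an x2 ax] := dic; split=> //.
  have ax' : a * x^-1 = x^-1 * a^-1.
    by rewrite -{1}[a]invgK -{1}ax -conjVg conjgE -mulgA mulgK.
  rewrite [RHS]expg2 -mulgA (mulgA a) ax' mulgVK -expg2 expVgn.
  by apply/esym/mulg1_eq; rewrite -expgnDr.
by rewrite mulVKg x2 -expgnDr addnn -mul2n.
Qed.

(** Here a = u v has a^n = u^2, and a * a^u = u v^2 u = u^4. *)
Lemma Pi0_dicyclic u v : Pi0_pair u v -> dicyclic_pair (u * v) u.
Proof.
case=> uv u4 an; have {}an : u ^+ 2 = (u * v) ^+ n.
  by apply: (mulgI (u ^+ 2)); rewrite an -expgnDr.
split=> //; first by rewrite mulnC expgnA -an -expgnA.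
apply/esym/mulg1_eq; rewrite conjgE -[u * v * u]mulgA mulKg.
by rewrite mulgA -(mulgA u) -expg2 -uv -expgS -expgSr.
Qed.

(** For n odd the n-th power of x^2 is x^2 = a^n, so that (a x^2)^n = a^n x^2 =
    x^4 = 1. *)
Lemma dicyclic_Pin a x : odd n -> dicyclic_pair a x -> Pin_pair (a * x ^+ 2) x.
Proof.
move=> n_odd dic; have x4 := dicyclic_expg4 dic; have [an x2 ax] := dic.
have a_x2 : commute a (x ^+ 2) by rewrite x2; apply: commuteX.
split=> //.
  by rewrite expgMn // -x2 (expg_odd_involution n_odd) -?expgnA -?expgnDr.
rewrite conjMg ax conjXg conjgE mulKg a_x2 invgM; congr (_ * _).
by apply/esym/mulg1_eq; rewrite -expgnDr.
Qed.

Lemma Pin_dicyclic b y : odd n -> Pin_pair b y -> dicyclic_pair (b * y ^+ 2) y.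
Proof.
move=> n_odd [bn y4 by_].
have b_y2 : commute b (y ^+ 2).
  by apply/commgP/conjg_fixP; rewrite expg2 conjgM by_ conjVg by_ invgK.
have an : y ^+ 2 = (b * y ^+ 2) ^+ n.
  by rewrite expgMn // bn mul1g (expg_odd_involution n_odd) -?expgnA.
split=> //; first by rewrite mulnC expgnA -an -expgnA.
rewrite conjMg by_ conjXg conjgE mulKg b_y2 invgM; congr (_ * _).
by apply/esym/mulg1_eq; rewrite -expgnDr.
Qed.

End Relations.

(** * A permutation model of the dicyclic group *)

Section Model.

Variables (n : nat) (n_gt1 : 1 < n).

Local Notation Z2n := 'Z_(2 * n).
Local Notation point := (Z2n * bool)%type.

(** The point (i, b) stands for the normal form a^i x^b, and the two maps are
    the right multiplications by a and by x on normal forms. *)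
Definition model_a_fun (p : point) : point :=
  (if p.2 then p.1 - 1 else p.1 + 1, p.2)%R.

Definition model_x_fun (p : point) : point :=
  (if p.2 then p.1 + n%:R else p.1, ~~ p.2)%R.

Lemma model_a_inj : injective model_a_fun.
Proof.
move=> [i b] [j c] [/= + bc]; rewrite -{}bc.
by case: b => e; rewrite (GRing.addIr _ e).
Qed.

Lemma model_x_inj : injective model_x_fun.
Proof.
move=> [i b] [j c] [/= + /negb_inj bc]; rewrite -{}bc.
by case: b => [e |-> //]; rewrite (GRing.addIr _ e).
Qed.

Definition model_a : {perm point} := perm model_a_inj.
Definition model_x : {perm point} := perm model_x_inj.

Lemma model_aX m (i : Z2n) b :
  (model_a ^+ m) (i, b) = (if b then i - m%:R else i + m%:R, b)%R.
Proof.
elim: m => [|m IHm].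
  by rewrite expg0 perm1 GRing.subr0 GRing.addr0; case: b.
rewrite expgSr permM IHm permE /model_a_fun /= GRing.mulrSr.
by case: (b); rewrite ?GRing.opprD GRing.addrA.
Qed.

Lemma natr_2n : ((2 * n)%N%:R = 0 :> Z2n)%R.
Proof. by rewrite char_Zp // (leq_trans n_gt1) // leq_pmull. Qed.

Lemma model_dicyclic : dicyclic_pair n model_a model_x.
Proof.
split.
- apply/permP => -[i b]; rewrite model_aX perm1 natr_2n.
  by rewrite GRing.subr0 GRing.addr0; case: b.
- apply/permP => -[i b]; rewrite model_aX permM !permE /model_x_fun /=.
  (* on both cosets x^2 translates by n, whereas a^n translates by n or -n,
     which agree modulo 2n *)
  case: b => //=; congr (_, _); apply/esym/eqP; rewrite -GRing.subr_eq0.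
  have -> : (i - n%:R - (i + n%:R) = - (2 * n)%N%:R :> Z2n)%R.
    by rewrite GRing.opprD GRing.addrACA GRing.subrr GRing.add0r -GRing.opprD
               -GRing.natrD addnn -mul2n.
  by rewrite natr_2n GRing.oppr0.
apply: (mulIg model_a); apply: (mulgI model_x).
rewrite mulVg mulg1 conjgE -mulgA mulVKg; apply/permP => -[i b].
rewrite !permM !permE /model_a_fun /model_x_fun /=.
by case: b; rewrite /= ?GRing.addrK // GRing.addrAC GRing.subrK.
Qed.

Lemma model_a_order : #[model_a] = (2 * n)%N.
Proof.
have [an _ _] := model_dicyclic.
apply/eqP; rewrite eqn_dvd order_dvdn an eqxx /=.
have := congr1 (fun s : {perm point} => (s (0%R, false)).1)
  (expg_order model_a).
rewrite model_aX perm1 /= GRing.add0r => /(congr1 val) /=.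
rewrite val_Zp_nat ?(leq_trans n_gt1) ?leq_pmull // => /eqP.
by rewrite -/(dvdn _ _).
Qed.

End Model.

(** * Generating pairs of the dicyclic group *)

Section GeneratingPairs.

Variables (gT : finGroupType) (n : nat) (n_gt1 : 1 < n).
Implicit Types (a x s t u v g z : gT).

(** The relations bound the order of a from above, and the homomorphism to the
    permutation model bounds it from below. *)
Lemma order_presentation a x :
  is_presentation [tuple a; x] (classical_rels n) -> #[a] = (2 * n)%N.
Proof.
move=> pres; have [an _ _] : dicyclic_pair n a x.
  exact/satisfies_classical/satisfies_presentation.
have [phi phiC] := presentation_hom pres
  ((satisfies_classical _ _ _).2 (model_dicyclic n_gt1)).
have phia : phi a = model_a n.
  by have /(congr1 (fun U => tnth U ord0)) := phiC; rewrite tnth_map.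
apply/eqP; rewrite eqn_dvd order_dvdn an eqxx /= -model_a_order //.
by rewrite order_dvdn -phia -gmulfXn expg_order gmulf1.
Qed.

(** A proper subsequence of a pair has at most one term, hence generates an
    abelian group. *)
Lemma minimal_noncommuting s t :
  generates [:: s; t] -> ~ commute s t -> minimal [tuple s; t].
Proof.
move=> gen_st st T subT neqT genT.
have abG : abelian [set: gT].
  rewrite -genT; have := size_subseq_leqif subT.
  case: T subT neqT {genT} => [|r [|r' T]] subT neqT /=.
  - by rewrite set_nil gen0 abelian1.
  - by rewrite set_cons set_nil setU0 cycle_abelian.
  by case=> le2 e2; case: neqT; apply/eqP; rewrite -e2 eqn_leq le2.
by apply: st; apply: (centsP abG); rewrite inE.
Qed.

Variables (a x : gT).
Variables (dic : dicyclic_pair n a x) (gen_ax : generates [:: a; x]).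
Variable (ord_a : #[a] = (2 * n)%N).

Lemma expg_an_neq1 : a ^+ n <> 1.
Proof.
move/eqP; rewrite -order_dvdn ord_a => /(dvdn_leq (ltnW n_gt1)).
by rewrite leqNgt ltn_Pmull // ltnW.
Qed.

Lemma dicyclic_noncommuting : ~ commute a x.
Proof.
have [_ _ ax] := dic => /commgP/conjg_fixP; rewrite ax => aV.
have /eqP : a ^+ 2 = 1 by rewrite expg2 -{1}aV mulVg.
rewrite -order_dvdn ord_a => /(@dvdn_leq _ 2 isT).
by rewrite leqNgt ltn_Pmulr.
Qed.

(** As in the dihedral case, the elements of <a> are called rotations and the
    other ones reflections. *)
Lemma conj_rotation : {in <[a]>, forall z, z ^ x = z^-1}.
Proof.
have [_ _ ax] := dic.
by move=> _ /cycleP[i ->]; rewrite conjXg ax expVgn.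
Qed.

Lemma expn_rotation : {in <[a]>, forall z, z ^+ n = 1 \/ z ^+ n = a ^+ n}.
Proof.
have [an _ _] := dic.
have an2 : a ^+ n ^+ 2 = 1 by rewrite -expgnA mulnC.
move=> _ /cycleP[i ->]; rewrite expgnAC.
case: (boolP (odd i)) => [i_odd | i_even].
  by right; apply: expg_odd_involution.
left; rewrite -[i]odd_double_half (negPf i_even) add0n -mul2n expgnA an2.
exact: expg1n.
Qed.

Lemma rotation_swap c : c \in <[a]> -> x * c = c^-1 * x.
Proof.
by move=> ca; rewrite [RHS]conjgC conj_rotation ?groupV ?invgK.
Qed.

Lemma dicyclic_cosets g : g \notin <[a]> -> exists2 c, c \in <[a]> & g = c * x.
Proof.
have [_ x2 _] := dic.
suff: g \in <[a]> \/ exists2 c, c \in <[a]> & g = c * x by case=> // ->.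
move: g; apply: (generates_ind gen_ax) => [|s]; first by left.
rewrite !inE => /orP[] /eqP-> g [ga | [c ca ->]].
- by left; rewrite groupM ?cycle_id.
- by right; exists (a * c); rewrite ?mulgA ?groupM ?cycle_id.
- by right; exists g^-1; rewrite ?groupV ?rotation_swap.
- left; rewrite mulgA rotation_swap // -mulgA -expg2 x2.
  by rewrite groupM ?groupV ?mem_cycle.
Qed.

Lemma reflection_sqr g : g \notin <[a]> -> g ^+ 2 = a ^+ n.
Proof.
have [_ x2 _] := dic; case/dicyclic_cosets=> c ca ->.
by rewrite expg2 mulgA -(mulgA c) rotation_swap // mulVKg -expg2.
Qed.

Lemma conj_reflection g : g \notin <[a]> -> {in <[a]>, forall z, z ^ g = z^-1}.
Proof.
case/dicyclic_cosets=> c ca -> z za.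
have /commgP/conjg_fixP zc : commute z c by apply: (centsP (cycle_abelian a)).
by rewrite conjgM zc conj_rotation.
Qed.

Lemma mulVg_reflections s t :
  s \notin <[a]> -> t \notin <[a]> -> s^-1 * t \in <[a]>.
Proof.
case/dicyclic_cosets=> c ca -> /dicyclic_cosets[d da ->].
rewrite invgM -mulgA (mulgA _ d) -/(conjg _ _) conj_rotation.
  by rewrite groupV groupM ?groupV.
by rewrite groupM ?groupV.
Qed.

(** As t normalises <c>, the pair generates <c><t>.  If a = c^i t^j, then j is
    even, because t is not in <a>, so that t^j is a power of a^n; taking n-th
    powers gives a^n = 1, a contradiction. *)
Lemma even_not_generates c t : ~~ odd n -> c \in <[a]> -> c ^+ n = 1 ->
  t \notin <[a]> -> ~ generates [:: c; t].
Proof.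
move=> n_even ca cn ta gen_ct.
have nct : <[t]> \subset 'N(<[c]>).
  rewrite cycle_subG inE -cycleJ conj_reflection // cycle_subG.
  by rewrite groupV cycle_id.
have : a \in <[c]> * <[t]>.
  rewrite -norm_joinEr //; have : a \in <<[set:: [:: c; t]]>>.
    by rewrite gen_ct inE.
  apply/subsetP; rewrite gen_subG; apply/subsetP => g.
  rewrite !inE => /orP[] /eqP->; apply: mem_gen;
    by rewrite inE cycle_id ?orbT.
case/mulsgP=> _ _ /cycleP[i ->] /cycleP[j ->] aE.
have [[an _ _] t2] := (dic, reflection_sqr ta).
move: aE; rewrite -[j]odd_double_half -mul2n.
case: (odd j) => /=; rewrite ?add0n ?add1n ?expgS expgnA t2 => aE.
  case/negP: ta; have := cycle_id a; rewrite [X in X \in _]aE.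
  by rewrite groupMl ?groupMr // groupX ?mem_cycle.
apply: expg_an_neq1; rewrite {1}aE expgMn; last first.
  by apply: (centsP (cycle_abelian a));
    [apply: groupX | apply/groupX/mem_cycle].
have ann : a ^+ n ^+ n = 1.
  rewrite -[X in _ ^+ X]odd_double_half (negPf n_even) add0n -mul2n.
  by rewrite -expgnA mulnA (mulnC n) expgnA an expg1n.
by rewrite (expgnAC c) cn (expgnAC (a ^+ n)) ann !expg1n mulg1.
Qed.

(** The dichotomy s^n = a^n or s^n = 1 decides which relations hold. *)
Lemma rotation_reflection_pair s t :
    s \in <[a]> -> t \notin <[a]> -> generates [:: s; t] ->
  dicyclic_pair n s t \/ odd n /\ Pin_pair n s t.
Proof.
move=> sa ta gen_st; have [an _ _] := dic; have t2 := reflection_sqr ta.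
have ts := conj_reflection ta sa.
have t4 : t ^+ 4 = 1 by rewrite (expgnA t 2 2) t2 -expgnA mulnC.
case: (expn_rotation sa) => sn; last first.
  by left; split; rewrite ?sn // mulnC expgnA sn -expgnA mulnC.
right; split=> //; case: (boolP (odd n)) => // n_even.
by case: (even_not_generates n_even sa sn ta gen_st).
Qed.

(** The dichotomy is now on the n-th power of c = s^-1 t = s^3 t, and
    s t = s^2 c. *)
Lemma reflection_pair s t :
    s \notin <[a]> -> t \notin <[a]> -> generates [:: s; t] ->
  Pi1_pair n s t \/ odd n /\ Pi0_pair n s t.
Proof.
move=> sa ta gen_st; have [an _ _] := dic.
have [s2 t2] := (reflection_sqr sa, reflection_sqr ta).
have s4 : s ^+ 4 = 1 by rewrite (expgnA s 2 2) s2 -expgnA mulnC.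
have sV : s^-1 = s ^+ 3 by apply/mulg1_eq; rewrite -expgS.
have ca := mulVg_reflections sa ta.
case: (expn_rotation ca) => cn; last first.
  by left; split; rewrite ?t2 // -sV cn s2 -expgnDr addnn -mul2n.
right; case: (boolP (odd n)) => [n_odd | n_even]; last first.
  case: (even_not_generates n_even ca cn sa); apply/eqP.
  rewrite -subTset -gen_st gen_subG; apply/subsetP => g.
  have cG : s^-1 * t \in <<[set:: [:: s^-1 * t; s]]>>.
    by apply: mem_gen; rewrite !inE eqxx.
  have sG : s \in <<[set:: [:: s^-1 * t; s]]>>.
    by apply: mem_gen; rewrite !inE eqxx orbT.
  by rewrite !inE => /orP[] /eqP->; rewrite // -{1}(mulVKg s t) groupM.
split=> //; split; rewrite ?t2 //.
have -> : s * t = s ^+ 2 * (s^-1 * t) by rewrite expg2 -mulgA mulVKg.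
rewrite expgMn; last first.
  by rewrite s2; apply: (centsP (cycle_abelian a)); rewrite ?mem_cycle.
by rewrite cn mulg1 (expg_odd_involution n_odd) -?expgnA -?expgnDr.
Qed.

Lemma generating_pair_cases s t : generates [:: s; t] ->
  exists s' t', [:: s'; t'] =i [:: s; t] /\
    [\/ dicyclic_pair n s' t', Pi1_pair n s' t', odd n /\ Pi0_pair n s' t'
      | odd n /\ Pin_pair n s' t'].
Proof.
move=> gen_st; have gen_ts : generates [:: t; s].
  rewrite /generates -gen_st; congr <<_>>; apply/setP=> g.
  by rewrite !inE orbC.
case: (boolP (s \in <[a]>)) => sa; case: (boolP (t \in <[a]>)) => ta.
- case: dicyclic_noncommuting; apply: (centsP (cycle_abelian a)).
    exact: cycle_id.
  suff -> : <[a]> = setT by rewrite inE.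
  apply/eqP; rewrite -subTset -gen_st gen_subG; apply/subsetP=> g.
  by rewrite !inE => /orP[] /eqP->.
- exists s, t; split=> //.
  by case: (rotation_reflection_pair sa ta gen_st);
    [constructor 1 | constructor 4].
- exists t, s; split; first by move=> g; rewrite !inE orbC.
  by case: (rotation_reflection_pair ta sa gen_ts);
    [constructor 1 | constructor 4].
- exists s, t; split=> //.
  by have [] := reflection_pair sa ta gen_st; [constructor 2 | constructor 3].
Qed.

End GeneratingPairs.

(** * Invariants of equivalent pairs *)

Lemma pair_tupleP (T : Type) (U : 2.-tuple T) : exists s t, U = [tuple s; t].
Proof.
case/tupleP: U => s U; case/tupleP: U => t U; rewrite (tuple0 U).
by exists s, t; apply: val_inj.
Qed.

Section Invariants.

Variable gT : finGroupType.
Implicit Types (s t u v : gT) (S T : seq gT).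

Lemma order4 s : s ^+ 4 = 1 -> s ^+ 2 <> 1 -> #[s] = 4.
Proof.
move/eqP; rewrite -order_dvdn => d4 /eqP; rewrite -order_dvdn.
by have := dvdn_leq (isT : 0 < 4) d4; case: #[s] d4 => [|[|[|[|[|]]]]].
Qed.

Lemma order4_pair u v s :
    u ^+ 2 = v ^+ 2 -> u ^+ 4 = 1 -> u ^+ 2 <> 1 -> s \in [:: u; v] ->
  #[s] = 4.
Proof.
move=> uv u4 u2; rewrite !inE => /orP[] /eqP->; apply: order4; rewrite -?uv //.
by rewrite (expgnA v 2 2) -uv -expgnA.
Qed.

Lemma order_hom (phi : UMagmaMorphism.type gT gT) s :
  bijective phi -> #[phi s] = #[s].
Proof.
move=> phi_bij; have phiX k : ((phi s) ^+ k == 1) = (s ^+ k == 1).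
  by rewrite -gmulfXn gmulf_eq1 //; apply: bij_inj.
apply/eqP; rewrite eqn_dvd !order_dvdn phiX -order_dvdn dvdnn /=.
by rewrite -phiX expg_order.
Qed.

Lemma equivalent_order S T s :
  generates S -> equivalent S T -> s \in S -> exists2 t, t \in T & #[t] = #[s].
Proof.
move=> genS /(equivalent_hom genS)[phi phi_bij phiS] sS.
by exists (phi s); [rewrite -phiS map_f | apply: order_hom].
Qed.

Lemma inequivalent_order S T s :
    generates S -> s \in S -> {in T, forall t, #[t] <> #[s]} ->
  ~ equivalent S T.
Proof.
by move=> genS sS neqT /(equivalent_order genS)/(_ sS)[t /neqT].
Qed.

(** Exchanging u and v replaces u^-1 v by its inverse, so that the condition
    depends only on the set {u, v}. *)
Lemma equivalent_div_expg s t u v n :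
    generates [:: s; t] -> equivalent [:: s; t] [:: u; v] ->
  (u^-1 * v) ^+ n = 1 -> (s^-1 * t) ^+ n = 1.
Proof.
move=> gen_st /(equivalent_hom gen_st)[phi phi_bij phi_st] uv.
have vu : (v^-1 * u) ^+ n = 1.
  by rewrite -[v^-1 * u]invgK invgM invgK expVgn uv invg1.
apply/eqP; rewrite -(@gmulf_eq1 _ _ phi) ?gmulfXn ?gmulfM ?gmulfV //;
  last exact: bij_inj.
have: phi s \in [:: u; v] by rewrite -phi_st map_f ?mem_head.
have: phi t \in [:: u; v] by rewrite -phi_st map_f ?inE ?eqxx ?orbT.
rewrite !inE => /orP[] /eqP-> /orP[] /eqP->; apply/eqP;
  by rewrite // mulVg expg1n.
Qed.

End Invariants.

(** * The listed presentations and their generators *)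

Section Presentations.

Variables (gT : finGroupType) (n : nat).
Implicit Types a x u v b y s t : gT.

Lemma generates_sub (S T : seq gT) :
  generates S -> {subset S <= <<[set:: T]>>} -> generates T.
Proof.
move=> genS subST; apply/eqP; rewrite -subTset -genS gen_subG.
by apply/subsetP => s; rewrite inE; apply: subST.
Qed.

Lemma gen_sub2 (T : seq gT) s t :
    s \in <<[set:: T]>> -> t \in <<[set:: T]>> ->
  {subset [:: s; t] <= <<[set:: T]>>}.
Proof. by move=> sT tT g; rewrite !inE => /orP[] /eqP->. Qed.

Lemma mem_gen_pair s t :
  s \in <<[set:: [:: s; t]]>> /\ t \in <<[set:: [:: s; t]]>>.
Proof. by split; apply: mem_gen; rewrite !inE eqxx ?orbT. Qed.

Lemma pair_hom (Q : groupType) (phi : UMagmaMorphism.type gT Q) s t (q r : Q) :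
  map_tuple phi [tuple s; t] = [tuple q; r] <-> phi s = q /\ phi t = r.
Proof.
split=> [/(congr1 val) [-> ->] // | [<- <-]].
exact: val_inj.
Qed.

(** In every group where u and v satisfy the relations of Pi_{4n,1}, von Dyck's
    theorem for (a, x) |-> (u^3 v, u) gives a homomorphism that sends x a to
    u^4 v = v. *)
Lemma presentation_Pi1 a x :
  is_presentation [tuple a; x] (classical_rels n) ->
  is_presentation [tuple x; x * a] (Pi1_rels n).
Proof.
move=> pres; apply: universal_presentation.
- have [xT xaT] := mem_gen_pair x (x * a); have [genC _] := pres.
  apply: (generates_sub genC); apply: gen_sub2 => //.
  by rewrite -{1}(mulKg x a) groupM ?groupV.
- apply/satisfies_Pi1/dicyclic_Pi1/satisfies_classical.
  exact: satisfies_presentation.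
move=> Q U; have [u [v ->]] := pair_tupleP U => /satisfies_Pi1 uv.
have [phi /pair_hom[phia phix]] := presentation_hom pres
  ((satisfies_classical _ _ _).2 (Pi1_dicyclic uv)).
exists phi; apply/pair_hom; split=> //.
have [_ u4 _] := uv.
by rewrite gmulfM phia phix mulgA -expgS u4 mul1g.
Qed.

Lemma presentation_Pi0 a x :
  is_presentation [tuple a; x] (classical_rels n) ->
  is_presentation [tuple x; x^-1 * a] (Pi0_rels n).
Proof.
move=> pres; apply: universal_presentation.
- have [xT xaT] := mem_gen_pair x (x^-1 * a); have [genC _] := pres.
  apply: (generates_sub genC); apply: gen_sub2 => //.
  by rewrite -{1}(mulVKg x a) groupM.
- apply/satisfies_Pi0/dicyclic_Pi0/satisfies_classical.
  exact: satisfies_presentation.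
move=> Q U; have [u [v ->]] := pair_tupleP U => /satisfies_Pi0 uv.
have [phi /pair_hom[phia phix]] := presentation_hom pres
  ((satisfies_classical _ _ _).2 (Pi0_dicyclic uv)).
by exists phi; apply/pair_hom; split; rewrite // gmulfM gmulfV phia phix mulKg.
Qed.

Lemma presentation_Pin a x : odd n ->
  is_presentation [tuple a; x] (classical_rels n) ->
  is_presentation [tuple a * x ^+ 2; x] (Pin_rels n).
Proof.
move=> n_odd pres; apply: universal_presentation.
- have [axT xT] := mem_gen_pair (a * x ^+ 2) x; have [genC _] := pres.
  apply: (generates_sub genC); apply: gen_sub2 => //.
  by rewrite -{1}(mulgK (x ^+ 2) a) groupM ?groupV ?groupX.
- apply/satisfies_Pin/(dicyclic_Pin n_odd)/satisfies_classical.
  exact: satisfies_presentation.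
move=> Q U; have [b [y ->]] := pair_tupleP U => /satisfies_Pin bY.
have [phi /pair_hom[phia phix]] := presentation_hom pres
  ((satisfies_classical _ _ _).2 (Pin_dicyclic n_odd bY)).
exists phi; apply/pair_hom; split=> //.
have [_ y4 _] := bY.
by rewrite gmulfM gmulfXn phia phix -mulgA -expgnDr y4 mulg1.
Qed.

(** The classical presentation of the group by one pair (a0, x0) gives, for
    every other generating pair that satisfies the same relations, the exact
    order of its first member; the substitutions carry this information over to
    the other three kinds of pairs. *)
Section Classes.

Variables (n_gt1 : 1 < n) (a0 x0 : gT).
Variable presC : is_presentation [tuple a0; x0] (classical_rels n).

Lemma dicyclic_order a x :
  generates [:: a; x] -> dicyclic_pair n a x -> #[a] = (2 * n)%N.
Proof.
move=> gen_ax dic; apply: (order_presentation n_gt1 (x := x)).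
by apply: (satisfies_is_presentation presC) => //; apply/satisfies_classical.
Qed.

Lemma noncommuting a x :
  generates [:: a; x] -> dicyclic_pair n a x -> ~ commute a x.
Proof.
move=> gen_ax dic.
exact: (dicyclic_noncommuting n_gt1 dic (dicyclic_order gen_ax dic)).
Qed.

Lemma dicyclic_expg2 a x :
  generates [:: a; x] -> dicyclic_pair n a x -> x ^+ 2 <> 1.
Proof.
move=> gen_ax dic; have [_ -> _] := dic.
exact: (expg_an_neq1 n_gt1 (dicyclic_order gen_ax dic)).
Qed.

Lemma Pi1_generates u v :
  generates [:: u; v] -> generates [:: u ^+ 3 * v; u].
Proof.
move=> gen_uv; have [aT uT] := mem_gen_pair (u ^+ 3 * v) u.
apply: (generates_sub gen_uv); apply: gen_sub2 => //.
by rewrite -{1}(mulKg (u ^+ 3) v) groupM ?groupV ?groupX.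
Qed.

Lemma Pi0_generates u v : generates [:: u; v] -> generates [:: u * v; u].
Proof.
move=> gen_uv; have [aT uT] := mem_gen_pair (u * v) u.
apply: (generates_sub gen_uv); apply: gen_sub2 => //.
by rewrite -{1}(mulKg u v) groupM ?groupV.
Qed.

Lemma Pin_generates b y : generates [:: b; y] -> generates [:: b * y ^+ 2; y].
Proof.
move=> gen_by; have [aT yT] := mem_gen_pair (b * y ^+ 2) y.
apply: (generates_sub gen_by); apply: gen_sub2 => //.
by rewrite -{1}(mulgK (y ^+ 2) b) groupM ?groupV ?groupX.
Qed.

Lemma minimal_classical a x :
  generates [:: a; x] -> dicyclic_pair n a x -> minimal [tuple a; x].
Proof.
by move=> gen_ax dic; apply: minimal_noncommuting => //; apply: noncommuting.
Qed.

Lemma minimal_Pi1 u v :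
  generates [:: u; v] -> Pi1_pair n u v -> minimal [tuple u; v].
Proof.
move=> gen_uv uv; apply: minimal_noncommuting => // cuv.
apply: (noncommuting (Pi1_generates gen_uv) (Pi1_dicyclic uv)).
by apply/commute_sym/commuteM => //; apply: commuteX.
Qed.

Lemma minimal_Pi0 u v :
  generates [:: u; v] -> Pi0_pair n u v -> minimal [tuple u; v].
Proof.
move=> gen_uv uv; apply: minimal_noncommuting => // cuv.
apply: (noncommuting (Pi0_generates gen_uv) (Pi0_dicyclic uv)).
by apply/commute_sym/commuteM.
Qed.

Lemma minimal_Pin b y :
  odd n -> generates [:: b; y] -> Pin_pair n b y -> minimal [tuple b; y].
Proof.
move=> n_odd gen_by bY; apply: minimal_noncommuting => // cby.
apply: (noncommuting (Pin_generates gen_by) (Pin_dicyclic n_odd bY)).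
by apply/commute_sym/commuteM; [apply: commute_sym | apply: commuteX].
Qed.

Lemma order_Pi1 u v g :
  generates [:: u; v] -> Pi1_pair n u v -> g \in [:: u; v] -> #[g] = 4.
Proof.
move=> gen_uv uv; have [u2 u4 _] := uv; apply: order4_pair => //.
exact: (dicyclic_expg2 (Pi1_generates gen_uv) (Pi1_dicyclic uv)).
Qed.

Lemma order_Pi0 u v g :
  generates [:: u; v] -> Pi0_pair n u v -> g \in [:: u; v] -> #[g] = 4.
Proof.
move=> gen_uv uv; have [u2 u4 _] := uv; apply: order4_pair => //.
exact: (dicyclic_expg2 (Pi0_generates gen_uv) (Pi0_dicyclic uv)).
Qed.

(** As u^-1 = u^3, the last relation identifies the n-th power of u^-1 v with
    u^2, an involution. *)
Lemma div_expg_Pi1 u v :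
  generates [:: u; v] -> Pi1_pair n u v -> (u^-1 * v) ^+ n <> 1.
Proof.
move=> gen_uv uv; have [u2 u4 an] := uv.
have -> : u^-1 = u ^+ 3 by apply/mulg1_eq; rewrite -expgS.
move=> vn; apply: (dicyclic_expg2 (Pi1_generates gen_uv) (Pi1_dicyclic uv)).
by rewrite -an vn mulg1.
Qed.

(** Here u^-1 v = u^2 (u v) with commuting factors, which both have the n-th
    power u^2 since n is odd. *)
Lemma div_expg_Pi0 u v : odd n -> Pi0_pair n u v -> (u^-1 * v) ^+ n = 1.
Proof.
move=> n_odd [u2 u4 an].
have u2V : u^-1 ^+ 2 = u ^+ 2.
  by rewrite expVgn; apply/mulg1_eq; rewrite -expgnDr.
have -> : u^-1 * v = u ^+ 2 * (u * v) by rewrite -u2V expg2 -mulgA mulKg.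
rewrite expgMn; last first.
  apply: commuteM; first exact/commute_sym/commuteX.
  by rewrite u2; apply/commute_sym/commuteX.
by rewrite (expg_odd_involution n_odd) -?expgnA.
Qed.

Lemma inequivalent_Pi u v u' v' : odd n ->
    generates [:: u; v] -> Pi1_pair n u v -> Pi0_pair n u' v' ->
  ~ equivalent [:: u; v] [:: u'; v'].
Proof.
move=> n_odd gen_uv uv uv' eqv; apply: (div_expg_Pi1 gen_uv uv).
exact: (equivalent_div_expg gen_uv eqv (div_expg_Pi0 n_odd uv')).
Qed.

End Classes.
End Presentations.

Lemma generating_tuple_cases (gT : finGroupType) (n : nat) (a x : gT)
    (S : 2.-tuple gT) :
    1 < n -> dicyclic_pair n a x -> generates [:: a; x] -> #[a] = (2 * n)%N ->
    generates S ->
  exists s t, [/\ generates [:: s; t], S =i [:: s; t]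
    & [\/ dicyclic_pair n s t, Pi1_pair n s t, odd n /\ Pi0_pair n s t
       | odd n /\ Pin_pair n s t]].
Proof.
move=> n_gt1 dic gen_ax ord_a; have [s [t ->]] := pair_tupleP S => gen_S.
have [s' [t' [eqst cases]]] :=
  generating_pair_cases n_gt1 dic gen_ax ord_a gen_S.
exists s', t'; split=> //.
rewrite /generates -gen_S; congr <<_>>; apply/setP=> g; rewrite !inE.
by have := eqst g; rewrite !inE.
Qed.

(** * The classification *)

Lemma pairwise_inequivalent1 (gT : finGroupType) (T : 2.-tuple gT) :
  pairwise_inequivalent [:: T].
Proof. by move=> i j; rewrite (ord1 i) (ord1 j). Qed.

Lemma pairwise_inequivalent_cons (gT : finGroupType) (T : 2.-tuple gT)
    (reps : seq (2.-tuple gT)) :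
    (forall T', T' \in reps -> ~ equivalent T T') ->
    pairwise_inequivalent reps ->
  pairwise_inequivalent (T :: reps).
Proof.
move=> ineqT ineq_reps i j; rewrite !(tnth_nth T) /=.
case: i j => [[|i] lti] [[|j] ltj] //= neq_ij.
- exact/ineqT/mem_nth.
- by move/equivalent_sym; apply: ineqT; apply: mem_nth.
have := ineq_reps (Ordinal (lti : i < size reps))
  (Ordinal (ltj : j < size reps)) neq_ij.
by rewrite !(tnth_nth T).
Qed.

Theorem theorem1p1 (n : nat) (n_ge2 : 2 <= n) (gT : finGroupType)
    (C : 2.-tuple gT) (DC : is_presentation C (classical_rels n)) :
  (2 %| n ->
     (exists T1 : 2.-tuple gT, is_presentation T1 (Pi1_rels n))
     /\ forall T1 : 2.-tuple gT,
          is_presentation T1 (Pi1_rels n) ->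
          cover_classes [:: C; T1]
          /\ (n <> 2 -> pairwise_inequivalent [:: C; T1]))
  /\
  (~~ (2 %| n) ->
     [/\ exists T1 : 2.-tuple gT, is_presentation T1 (Pi1_rels n),
         exists T0 : 2.-tuple gT, is_presentation T0 (Pi0_rels n)
       & exists Tn : 2.-tuple gT, is_presentation Tn (Pin_rels n)]
     /\ forall T1 T0 Tn : 2.-tuple gT,
          is_presentation T1 (Pi1_rels n) ->
          is_presentation T0 (Pi0_rels n) ->
          is_presentation Tn (Pin_rels n) ->
          cover_classes [:: C; T1; T0; Tn]
          /\ pairwise_inequivalent [:: C; T1; T0; Tn]).
Proof.
have [a [x defC]] := pair_tupleP C; rewrite {}defC in DC *.
have [gen_ax _] := DC.
have dic : dicyclic_pair n a x.
  exact/satisfies_classical/satisfies_presentation.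
have ord_a := dicyclic_order n_ge2 DC gen_ax dic.
have minC := minimal_classical n_ge2 DC gen_ax dic.
rewrite dvdn2 negbK; split=> [n_even | n_odd].
  split=> [|T1 presT1].
    by exists [tuple x; x * a]; apply: presentation_Pi1.
  have [u [v defT1]] := pair_tupleP T1; rewrite {}defT1 in presT1 *.
  have [gen_uv _] := presT1.
  have uv : Pi1_pair n u v by apply/satisfies_Pi1/satisfies_presentation.
  have minT1 := minimal_Pi1 n_ge2 DC gen_uv uv.
  have ord_uv := order_Pi1 n_ge2 DC gen_uv uv.
  split; last first.
    move=> n_neq2.
    apply: pairwise_inequivalent_cons => [T|];
      last exact: pairwise_inequivalent1.
    rewrite inE => /eqP->.
    apply: (inequivalent_order gen_ax (mem_head a _)) => g /ord_uv ->.
    rewrite ord_a => e4; apply: n_neq2; apply/eqP.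
    by rewrite -(eqn_pmul2l (isT : 0 < 2)) -e4.
  split=> [T | S R [gen_S _] _]; first by rewrite !inE => /orP[] /eqP->.
  have [s [t [gen_st eqst cases]]] :=
    generating_tuple_cases n_ge2 dic gen_ax ord_a gen_S.
  case: cases => [st|st|[n_odd _]|[n_odd _]]; last 2 first.
  - by rewrite n_odd in n_even.
  - by rewrite n_odd in n_even.
  - exists [tuple a; x]; first exact: mem_head.
    by apply: (satisfies_equivalent DC gen_st) => //; apply/satisfies_classical.
  exists [tuple u; v]; first by rewrite !inE eqxx orbT.
  by apply: (satisfies_equivalent presT1 gen_st) => //; apply/satisfies_Pi1.
split=> [|T1 T0 Tn presT1 presT0 presTn].
  split; first by exists [tuple x; x * a]; apply: presentation_Pi1.
    by exists [tuple x; x^-1 * a]; apply: presentation_Pi0.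
  by exists [tuple a * x ^+ 2; x]; apply: presentation_Pin.
have [u [v defT1]] := pair_tupleP T1; rewrite {}defT1 in presT1 *.
have [gen_uv _] := presT1.
have uv : Pi1_pair n u v by apply/satisfies_Pi1/satisfies_presentation.
have [u0 [v0 defT0]] := pair_tupleP T0; rewrite {}defT0 in presT0 *.
have [gen_uv0 _] := presT0.
have uv0 : Pi0_pair n u0 v0 by apply/satisfies_Pi0/satisfies_presentation.
have [b [y defTn]] := pair_tupleP Tn; rewrite {}defTn in presTn *.
have [gen_by _] := presTn.
have bY : Pin_pair n b y by apply/satisfies_Pin/satisfies_presentation.
have minT1 := minimal_Pi1 n_ge2 DC gen_uv uv.
have minT0 := minimal_Pi0 n_ge2 DC gen_uv0 uv0.
have minTn := minimal_Pin n_ge2 DC n_odd gen_by bY.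
have ord_uv := order_Pi1 n_ge2 DC gen_uv uv.
have ord_uv0 := order_Pi0 n_ge2 DC gen_uv0 uv0.
have ord_b : #[b] %| n by have [bn _ _] := bY; rewrite order_dvdn bn.
have ord_y : #[y] = 4.
  have dic_y := Pin_dicyclic n_odd bY; have gen_y := Pin_generates gen_by.
  exact: (order4 (dicyclic_expg4 dic_y) (dicyclic_expg2 n_ge2 DC gen_y dic_y)).
split.
  split=> [T | S R [gen_S _] _]; first by rewrite !inE => /or4P[] /eqP->.
  have [s [t [gen_st eqst cases]]] :=
    generating_tuple_cases n_ge2 dic gen_ax ord_a gen_S.
  case: cases => [st|st|[_ st]|[_ st]].
  - exists [tuple a; x]; first exact: mem_head.
    by apply: (satisfies_equivalent DC gen_st) => //; apply/satisfies_classical.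
  - exists [tuple u; v]; first by rewrite !inE eqxx ?orbT.
    by apply: (satisfies_equivalent presT1 gen_st) => //; apply/satisfies_Pi1.
  - exists [tuple u0; v0]; first by rewrite !inE eqxx ?orbT.
    by apply: (satisfies_equivalent presT0 gen_st) => //; apply/satisfies_Pi0.
  - exists [tuple b; y]; first by rewrite !inE eqxx ?orbT.
    by apply: (satisfies_equivalent presTn gen_st) => //; apply/satisfies_Pin.
have n_gt0 := ltnW n_ge2.
have neq4 : 4 <> #[a].
  rewrite ord_a => /(congr1 half); rewrite mul2n doubleK => n2.
  by rewrite -n2 in n_odd.
have neq_b4 : 4 <> #[b].
  by move=> e4; have := dvdn_odd ord_b n_odd; rewrite -e4.
apply: pairwise_inequivalent_cons => [T|].
  rewrite !inE => /or3P[] /eqP->;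
    apply: (inequivalent_order gen_ax (mem_head a _)) => g.
  - by move/ord_uv->.
  - by move/ord_uv0->.
  rewrite !inE => /orP[] /eqP->; rewrite ?ord_y // ord_a => eq_b.
  by have := dvdn_leq n_gt0 ord_b; rewrite eq_b leqNgt ltn_Pmull.
apply: pairwise_inequivalent_cons => [T|].
  rewrite !inE => /orP[] /eqP->; first exact: (inequivalent_Pi n_ge2 DC).
  move/equivalent_sym; apply: (inequivalent_order gen_by (mem_head b _)) => g.
  by move/ord_uv->.
apply: pairwise_inequivalent_cons => [T|]; last exact: pairwise_inequivalent1.
rewrite inE => /eqP-> /equivalent_sym.
by apply: (inequivalent_order gen_by (mem_head b _)) => g /ord_uv0->.
Qed.
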